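(* For every prime $p > 2.67\times 10^{32}$, the least primitive root $g(p)$ modulo $p$ satisfies $g(p) < p^{0.6309}$.
   Context: For a prime $p$, $g(p)$ denotes the least positive integer that is a primitive root modulo $p$, i.e. a generator of the multiplicative group $(\mathbb{Z}/p\mathbb{Z})^\times$. *)

(* Defs.v *)
From Stdlib Require Import Arith ZArith Znumtheory Reals.

(* g is a primitive root modulo p: g is invertible mod p and its
   multiplicative order modulo p is p - 1, i.e. g generates
   (Z/pZ)^x (which has p - 1 elements for p prime). *)
Local Open Scope nat_scope.
Definition is_primitive_root (p g : nat) : Prop :=
  Nat.gcd g p = 1 /\
  (g ^ (p - 1)) mod p = 1 mod p /\
  (forall k : nat, 1 <= k -> k < p - 1 -> (g ^ k) mod p <> 1).

Definition least_primitive_root (p g : nat) : Prop :=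
  1 <= g /\ is_primitive_root p g /\
  (forall h : nat, 1 <= h -> h < g -> ~ is_primitive_root p h).

(* Main.v *)
Require Import Defs.
From mathcomp Require Import all_boot all_order all_algebra all_field all_solvable.
From mathcomp Require Import ring lra zify.

(** Let [m = p - 1] and let [e] be a product of some of the primes dividing [m]
    (the small ones); let [q_1, ..., q_s] be the remaining ones.  Let [A_0] be
    the set of residues that are [r]-th powers for no prime [r] dividing [e], and
    [A_j] the set of [q_j]-th powers in [A_0].  An element of [A_0] outside all
    the [A_j] is a primitive root.

    Each of these sets [A] is a union of cosets of a subgroup [L] of [F_p^*] with
    [|A| = phi(e) |L|], so its additive Fourier transform is [L]-invariant, and
    Parseval bounds every nonzero coefficient by [sqrt (p |A| / |L|) =
    sqrt (p phi(e))]; no multiplicative character is needed.  Hence the number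
    of pairs [(y, z)] in [{1..N}^2] with [y + z] in [A] is [N^2 |A| / p] up to
    an error of at most [(N - N^2 / p) sqrt (p phi(e))], without a logarithm.  If
    [1/q_1 + ... + 1/q_s <= 1 - 1/d] and [N^2 phi(e) > ((s + 1) d e)^2 p], the
    main terms win and there is a primitive root at most [2 N].

    This yields a primitive root below [p^(5/8)].  If [m] has at most 41 prime
    factors, take for [e] the product of those among 2, 3, 5 and [d = 11].
    Otherwise take the smallest seventh of the prime factors, so that [e^7 <= p],
    and [d = 5]; the sum of the reciprocals of the others is controlled because
    primes above 3 are coprime to 6. *)

Set Implicit Arguments. Unset Strict Implicit. Unset Printing Implicit Defensive.
Import Order.TTheory GRing.Theory Num.Theory.

(** * Sums of two elements of a set, by Fourier analysis *)

Local Open Scope ring_scope.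

Section Fourier.
Variables (F : finFieldType) (psi : F -> algC).
Hypothesis psi0 : psi 0 = 1.
Hypothesis psiD : forall x y, psi (x + y) = psi x * psi y.
Hypothesis psi_conj : forall x, (psi x)^* = psi (- x).
Hypothesis psi_nontriv : exists x, psi x != 1.

Definition fourier (f : F -> algC) (t : F) : algC := \sum_x f x * psi (t * x).

(** For [x != 0], translating [t] by [y / x] with [psi y != 1] multiplies the sum by [psi y], so it
    vanishes. *)
Lemma sum_psi (x : F) : \sum_t psi (t * x) = if x == 0 then #|F|%:R else 0.
Proof.
have [->|x0] := eqVneq x 0.
  by under eq_bigr => t _ do rewrite mulr0 psi0; rewrite sumr_const.
have [y y1] := psi_nontriv.
set S := \sum_t _.
have /eqP : S * psi y = S.
  rewrite /S mulr_suml [RHS](reindex_inj (addIr (y / x))) /=.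
  by apply: eq_bigr => t _; rewrite mulrDl divfK // psiD.
by rewrite -subr_eq0 -{2}[S]mulr1 -mulrBr mulf_eq0 subr_eq0 (negPf y1) orbF => /eqP.
Qed.

Lemma fourier_parseval (f g : F -> algC) :
  \sum_t fourier f t * (fourier g t)^* = #|F|%:R * \sum_x f x * (g x)^*.
Proof.
transitivity (\sum_t \sum_x \sum_y f x * (g y)^* * psi (t * (x - y))).
  apply: eq_bigr => t _; rewrite /fourier rmorph_sum mulr_suml.
  apply: eq_bigr => x _; rewrite mulr_sumr; apply: eq_bigr => y _.
  by rewrite rmorphM /= psi_conj mulrBr psiD mulrACA.
rewrite exchange_big /= mulr_sumr; apply: eq_bigr => x _.
rewrite exchange_big /= (bigD1 x) //= [X in _ + X]big1 ?addr0 => [|y yx].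
  by rewrite -mulr_sumr sum_psi subrr eqxx mulrC.
by rewrite -mulr_sumr sum_psi subr_eq0 eq_sym (negPf yx) mulr0.
Qed.

Definition indic (A : {set F}) (x : F) : algC := (x \in A)%:R.

Lemma sum_indic (A : {set F}) : \sum_x indic A x = #|A|%:R.
Proof.
rewrite -sumr_const [RHS]big_mkcond; apply: eq_bigr => x _.
by rewrite /indic; case: ifP.
Qed.

Lemma fourier_indic0 (A : {set F}) : fourier (indic A) 0 = #|A|%:R.
Proof.
by rewrite -sum_indic; apply: eq_bigr => x _; rewrite mul0r psi0 mulr1.
Qed.

Lemma parseval_indic (A : {set F}) :
  \sum_t `|fourier (indic A) t| ^+ 2 = #|F|%:R * #|A|%:R.
Proof.
under eq_bigr do rewrite normCK.
rewrite fourier_parseval -sum_indic; congr (_ * _); apply: eq_bigr => x _.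
by rewrite /indic conjC_nat -natrM mulnb andbb.
Qed.

(** The coefficient is constant on the [#|L|] distinct frequencies [l * t], and Parseval bounds the
    sum of squares over these. *)
Lemma fourier_indic_le (A L : {set F}) (t : F) :
  0 \notin L -> (forall l x, l \in L -> (l * x \in A) = (x \in A)) -> t != 0 ->
  #|L|%:R * `|fourier (indic A) t| ^+ 2 <= #|F|%:R * #|A|%:R.
Proof.
move=> L0 LA t0; have Lnz l : l \in L -> l != 0.
  by move=> lL; apply: contraNneq L0 => <-.
have inv l : l \in L -> fourier (indic A) (l * t) = fourier (indic A) t.
  move=> lL; rewrite /fourier [RHS](reindex_inj (mulfI (Lnz _ lL))) /=.
  apply: eq_bigr => x _; rewrite /indic LA //; congr (_ * psi _).
  by rewrite mulrCA mulrA.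
rewrite -parseval_indic [leLHS]mulr_natl -sumr_const.
rewrite (eq_bigr (fun l => `|fourier (indic A) (l * t)| ^+ 2)) => [|l lL]; last by rewrite inv.
rewrite -(big_imset (fun u => `|fourier (indic A) u| ^+ 2) (h := fun l => l * t)) /=; last first.
  by move=> x y _ _ /(mulIf t0).
rewrite [leRHS](bigID (mem [set l * t | l in L])) /= lerDl.
by apply: sumr_ge0 => u _; rewrite exprn_ge0.
Qed.

Lemma fourier_sumset (f : F -> algC) (I : {set F}) :
  \sum_t fourier f t * ((fourier (indic I) t)^* ) ^+ 2 =
  #|F|%:R * \sum_(y in I) \sum_(z in I) f (y + z).
Proof.
(* This is the convolution of the indicator of [I] with itself, whose transform is a square;
   Parseval is then applied to [f] and [g]. *)
pose g x := \sum_y indic I y * indic I (x - y).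
have gE t : fourier g t = fourier (indic I) t ^+ 2.
  rewrite expr2 /fourier /g mulr_suml.
  under eq_bigr => x _ do rewrite mulr_suml.
  rewrite exchange_big; apply: eq_bigr => y _ /=.
  rewrite mulr_sumr (reindex_inj (addrI y)) /=; apply: eq_bigr => z _.
  by rewrite addrC addKr mulrDr psiD mulrACA.
under eq_bigr => t _ do rewrite -rmorphXn -gE.
rewrite fourier_parseval; congr (_ * _).
have gr x : (g x)^* = g x.
  rewrite /g rmorph_sum; apply: eq_bigr => y _.
  by rewrite rmorphM /= /indic !conjC_nat.
under eq_bigr => x _ do rewrite gr /g mulr_sumr.
rewrite exchange_big [RHS]big_mkcond; apply: eq_bigr => y _ /=.
rewrite (reindex_inj (addrI y)) /=.
rewrite {1}/indic; case: (y \in I); last first.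
  by apply: big1 => z _; rewrite /indic mul0r mulr0.
rewrite [RHS]big_mkcond; apply: eq_bigr => z _.
by rewrite /indic (addrC y) addrK; case: (z \in I); rewrite !(mulr0, mulr1).
Qed.

(** Frequency 0 in [fourier_sumset] is the main term. Elsewhere the coefficient of [A] is at most
    [kappa], and Parseval for [I] without its zero frequency gives the other factor, whence the
    saving of [#|I|%:R ^+ 2]. *)
Lemma sumset_count (A L I : {set F}) (kappa : algC) :
  0 \notin L -> (0 < #|L|)%N ->
  (forall l x, l \in L -> (l * x \in A) = (x \in A)) ->
  0 <= kappa -> (#|F| * #|A|)%:R <= kappa ^+ 2 * #|L|%:R ->
  `| #|F|%:R * (\sum_(y in I) \sum_(z in I) ((y + z)%R \in A))%:R - #|I|%:R ^+ 2 * #|A|%:R |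
    <= kappa * (#|F|%:R * #|I|%:R - #|I|%:R ^+ 2).
Proof.
move=> L0 Lpos LA k0 kL.
have -> : (\sum_(y in I) \sum_(z in I) ((y + z)%R \in A))%:R =
          \sum_(y in I) \sum_(z in I) indic A (y + z).
  by rewrite natr_sum; apply: eq_bigr => y _; rewrite natr_sum.
rewrite -fourier_sumset (bigD1 0) //= !fourier_indic0 conjC_nat.
rewrite [#|A|%:R * _]mulrC addrAC subrr add0r.
apply: le_trans (ler_norm_sum _ _ _) _.
rewrite -parseval_indic [X in kappa * (X - _)](bigD1 0) //= fourier_indic0.
rewrite normr_nat [X in kappa * X]addrAC subrr add0r.
rewrite mulr_sumr; apply: ler_sum => t t0.
rewrite normrM normrX norm_conjC ler_wpM2r ?exprn_ge0 //.
rewrite -(@ler_pXn2r _ 2) ?nnegrE //.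
rewrite -(@ler_pM2r _ #|L|%:R) ?ltr0n //; apply: le_trans kL.
by rewrite mulrC natrM fourier_indic_le.
Qed.

End Fourier.

(** * Sets defined by the discrete logarithm *)

Lemma sum_periodic (P : nat -> nat) (D c : nat) :
  (forall i, P (i + D)%N = P i) ->
  (\sum_(0 <= i < c * D) P i = c * \sum_(0 <= i < D) P i)%N.
Proof.
move=> per; elim: c => [|c IH]; first by rewrite !mul0n big_geq.
have perc k i : P (k * D + i)%N = P i.
  by elim: k => [|k IHk]; rewrite ?add0n // mulSn -addnA addnC per.
rewrite mulSn addnC (@big_cat_nat _ _ _ (c * D)) ?leq_addr //= IH mulSnr.
congr (_ + _)%N; rewrite -{1}[(c * D)%N]add0n big_addn addKn.
by apply: eq_bigr => i _; rewrite addnC perc.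
Qed.

Lemma sum_multiples (f : nat -> nat) (q e : nat) : (0 < q)%N ->
  (\sum_(0 <= i < e * q) (q %| i) * f i = \sum_(0 <= j < e) f (j * q))%N.
Proof.
move=> q0; elim: e => [|e IH]; first by rewrite !big_geq.
rewrite mulSn addnC (@big_cat_nat _ _ _ (e * q)) ?leq_addr //= IH big_nat_recr //=.
congr (_ + _)%N; rewrite -{1}[(e * q)%N]add0n big_addn addKn.
case: q q0 {IH} => // q _; rewrite big_nat_recl // big1_seq ?addn0 ?add0n ?dvdn_mull ?mul1n //.
move=> i; rewrite mem_index_iota /= => iq.
by rewrite dvdn_addl ?dvdn_mull // gtnNdvd.
Qed.

Lemma totient_sum (e : nat) : (\sum_(0 <= i < e) coprime e i = totient e)%N.
Proof. by rewrite totient_count_coprime. Qed.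

Lemma totient_sum_multiples (e q : nat) : (0 < q)%N -> coprime e q ->
  (\sum_(0 <= i < e * q) ((q %| i) && coprime e i) = totient e)%N.
Proof.
move=> q0 eq; rewrite -totient_sum.
under eq_bigr => i _ do rewrite -mulnb.
rewrite sum_multiples //.
by apply: eq_bigr => j _; rewrite coprimeMr eq andbT.
Qed.

(** The nonzero elements are [#|F|.-1] distinct roots of unity of that order, so one of them is
    primitive. *)
Lemma finField_prim_root (F : finFieldType) :
  exists g : F, (#|F|.-1).-primitive_root g.
Proof.
have F1 : (0 < #|F|.-1)%N by rewrite -subn1 subn_gt0 finNzRing_gt1.
have /hasP[g _ gP] : has (#|F|.-1).-primitive_root (enum [set~ (0 : F)]).
  apply: has_prim_root => //; last by rewrite -cardE cardsC1.
    apply/allP => x; rewrite mem_enum in_setC1 unity_rootE => x0.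
    rewrite -(inj_eq (mulfI x0)) -exprS prednK ?mulr1 ?expf_card //.
    by rewrite ltnW // finNzRing_gt1.
  exact: enum_uniq.
by exists g.
Qed.

Section ExponentSets.
Variables (F : finFieldType) (g : F).
Let m := #|F|.-1.
Hypothesis gprim : m.-primitive_root g.

Let m_gt0 : (0 < m)%N. Proof. exact: prim_order_gt0 gprim. Qed.

Definition expset (P : pred nat) : {set F} := [set g ^+ i | i : 'I_m & P i].

Lemma prim_root_neq0 : g != 0.
Proof.
apply/eqP => g0; have /eqP := prim_expr_order gprim.
by rewrite g0 expr0n gtn_eqF // eq_sym oner_eq0.
Qed.

Lemma expg_ord_inj (n : nat) : (n <= m)%N -> {in 'I_n &, injective (fun i : 'I_n => g ^+ i)}.
Proof.
move=> nm i j _ _ /eqP; rewrite (eq_prim_root_expr gprim) => /eqP.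
by rewrite !modn_small ?(leq_trans (ltn_ord _)) // => /val_inj.
Qed.

Lemma card_expset (P : pred nat) : #|expset P| = (\sum_(0 <= i < m) P i)%N.
Proof.
rewrite card_in_imset => [|i j _ _]; last exact: expg_ord_inj.
by rewrite big_mkord -sum1_card big_mkcond /=; apply: eq_bigr => i _; rewrite inE; case: (P i).
Qed.

Lemma mem_expset (P : pred nat) (i : nat) :
  (forall i, P (i + m)%N = P i) -> (g ^+ i \in expset P) = P i.
Proof.
move=> per; have perc k j : P (k * m + j)%N = P j.
  by elim: k => [|k IHk]; rewrite ?add0n // mulSn -addnA addnC per.
have -> : P i = P (i %% m)%N by rewrite {1}(divn_eq i m) perc.
apply/imsetP/idP => [[j Pj /eqP]|Pi].
  rewrite (eq_prim_root_expr gprim) (modn_small (ltn_ord j)) => /eqP ->.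
  by rewrite inE in Pj.
by exists (Ordinal (ltn_pmod i m_gt0)); rewrite ?inE //= (prim_expr_mod gprim).
Qed.

Lemma expset_exp (P : pred nat) (x : F) : x \in expset P -> exists i, x = g ^+ i.
Proof. by case/imsetP => i _ ->; exists i. Qed.

Variables (D : nat) (dvdDm : (D %| m)%N).

(** The subgroup of [D]-th powers, of index [D] because [D] divides [m]. *)
Definition expgroup : {set F} := expset (dvdn D).

Lemma zero_notin_expset (P : pred nat) : 0 \notin expset P.
Proof.
by apply/imsetP => -[i _ /eqP]; rewrite eq_sym expf_eq0 (negPf prim_root_neq0) andbF.
Qed.

Let D_gt0 : (0 < D)%N. Proof. exact: dvdn_gt0 dvdDm. Qed.

Lemma card_expgroup : (#|expgroup| = m %/ D)%N.
Proof.
rewrite card_expset -{1}(divnK dvdDm).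
under eq_bigr => i _ do rewrite -[nat_of_bool _]muln1.
by rewrite (sum_multiples (fun=> 1%N)) // sum_nat_const_nat subn0 muln1.
Qed.

Lemma expgroup_stable (P : pred nat) (l x : F) :
  (forall i, P (i + D)%N = P i) -> l \in expgroup ->
  (l * x \in expset P) = (x \in expset P).
Proof.
move=> per; have perc k j : P (j + k * D)%N = P j.
  by elim: k => [|k IHk]; rewrite ?addn0 // mulSn [(D + _)%N]addnC addnA per.
have perm i : P (i + m)%N = P i by rewrite -(divnK dvdDm) perc.
move=> lL; have [j lE] := expset_exp lL; move: lL.
rewrite lE mem_expset; last by move=> i; rewrite dvdn_addl.
case/dvdnP=> k jE.
have [->|x0] := eqVneq x 0; first by rewrite mulr0.
apply/idP/idP => /[dup] /expset_exp[i xE]; last first.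
  by rewrite xE -exprD !mem_expset // jE addnC perc.
(* The factor [g ^+ (j * m.-1)] is the inverse of [l = g ^+ j], so the converse is again a shift of
   exponents by a multiple of [D]. *)
have jm : g ^+ (j * m.-1) * (g ^+ j * x) = x.
  rewrite mulrA -exprD -mulnSr prednK // mulnC exprM (prim_expr_order gprim).
  by rewrite expr1n mul1r.
by rewrite -[x in _ -> x \in _]jm xE -exprD !mem_expset // jE mulnAC addnC perc.
Qed.

End ExponentSets.

(** * The sieve *)

(** The set has [f] times as many elements as the group of [D]-th powers, so in the Fourier bound
    [D] cancels and [kappa] depends on [f] alone. *)
Lemma sumset_expset_count (F : finFieldType) (psi : F -> algC) (g : F)
    (P : pred nat) (D f : nat) (I : {set F}) (kappa : algC) :
  psi 0 = 1 -> (forall x y, psi (x + y) = psi x * psi y) ->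
  (forall x, (psi x)^* = psi (- x)) -> (exists x, psi x != 1) ->
  (#|F|.-1).-primitive_root g -> (D %| #|F|.-1)%N ->
  (forall i, P (i + D)%N = P i) -> (\sum_(0 <= i < D) P i = f)%N ->
  0 <= kappa -> kappa ^+ 2 = (#|F| * f)%:R ->
  `| #|F|%:R * (\sum_(y in I) \sum_(z in I) ((y + z)%R \in expset g P))%:R
     - #|I|%:R ^+ 2 * (#|F|.-1 %/ D * f)%:R |
    <= kappa * (#|F|%:R * #|I|%:R - #|I|%:R ^+ 2).
Proof.
move=> psi0 psiD psic psi1 gP dvdD per sumP k0 k2.
have m0 := prim_order_gt0 gP.
have cP : #|expset g P| = (#|F|.-1 %/ D * f)%N.
  by rewrite card_expset // -{1}(divnK dvdD) sum_periodic ?sumP // => i; rewrite per.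
rewrite -cP; apply: (@sumset_count _ _ psi0 psiD psic psi1 _ (expgroup g D)) => //.
- exact: zero_notin_expset.
- rewrite card_expgroup // divn_gt0; last exact: dvdn_gt0 dvdD.
  exact: dvdn_leq dvdD.
- by move=> l x; apply: expgroup_stable.
- by rewrite k2 card_expgroup // cP -natrM mulnCA mulnA mulnC mulnA mulnAC [(f * _)%N]mulnC.
Qed.

Lemma sumset_prim_root (F : finFieldType) (psi : F -> algC) (I : {set F})
    (e d : nat) (qs : seq nat) :
  psi 0 = 1 -> (forall x y, psi (x + y) = psi x * psi y) ->
  (forall x, (psi x)^* = psi (- x)) -> (exists x, psi x != 1) ->
  (e %| #|F|.-1)%N -> (0 < d)%N ->
  {in qs, forall q, (q %| #|F|.-1)%N && coprime e q} ->
  (forall q, prime q -> (q %| #|F|.-1)%N -> (q %| e)%N || (q \in qs)) ->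
  \sum_(q <- qs) q%:R^-1 <= 1 - d%:R^-1 :> algC ->
  (((size qs).+1 * d * e) ^ 2 * #|F| < #|I| ^ 2 * totient e)%N ->
  exists y z, [/\ y \in I, z \in I & (#|F|.-1).-primitive_root (y + z)].
Proof.
move=> psi0 psiD psic psi1 dve d0 qsP cov sumq big.
have [g gP] := finField_prim_root F; set m := #|F|.-1 in qsP cov gP dve *.
have m0 : (0 < m)%N := prim_order_gt0 gP.
have e0 : (0 < e)%N := dvdn_gt0 m0 dve.
have q0 q : q \in qs -> (0 < q)%N by move/qsP => /andP[/(dvdn_gt0 m0)].
(* For a prime [r] dividing [m], [g ^+ i] is an [r]-th power exactly when [r] divides [i]; these
   predicates thus describe [A_0] and its subset of [q]-th powers. *)
pose P0 i := coprime e i; pose P q i := (q %| i)%N && coprime e i.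
have per0 i : P0 (i + e)%N = P0 i by rewrite /P0 /coprime gcdnDr.
have per q i : P q (i + e * q)%N = P q i.
  by rewrite /P dvdn_addl ?dvdn_mull // /coprime addnC mulnC gcdnMDl.
have perm0 i : P0 (i + m)%N = P0 i.
  by rewrite /P0 -(divnK dve) /coprime addnC gcdnMDl.
have perm q i : q \in qs -> P q (i + m)%N = P q i.
  move=> qq; have /andP[qm _] := qsP _ qq.
  by rewrite /P dvdn_addl //; congr (_ && _); exact: perm0.
pose r Q := (\sum_(y in I) \sum_(z in I) ((y + z)%R \in expset g Q))%N.
have F0 : (0 < #|F|)%N by rewrite ltnW // finNzRing_gt1.
have mE : (m.+1 = #|F|)%N by rewrite prednK.
have [/exists_inP[y yI /exists_inP[z zI yz]]|noprim] :=
  boolP [exists y in I, exists z in I, m.-primitive_root (y + z)].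
  by exists y, z.
(* If [y + z = g ^+ i] lies in [A_0] but is no primitive root, some prime divides both [i] and [m].
   It cannot divide [e], so it is one of the [qs]. *)
have cover : (r P0 <= \sum_(q <- qs) r (P q))%N.
  rewrite /r [leqRHS]exchange_big; apply: leq_sum => y yI.
  rewrite [leqRHS]exchange_big; apply: leq_sum => z zI.
  have [yzP|//] := boolP (_ \in expset g P0).
  have [i yzE] := expset_exp yzP; move: yzP; rewrite yzE mem_expset // => P0i.
  have : ~~ coprime i m.
    rewrite -(prim_root_exp_coprime i gP) -yzE.
    apply: contra noprim => yzg; apply/exists_inP; exists y => //.
    by apply/exists_inP; exists z.
  rewrite /coprime => im.
  have ql : prime (pdiv (gcdn i m)).
    by rewrite pdiv_prime // ltn_neqAle eq_sym im gcdn_gt0 m0 orbT.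
  set q := pdiv _ in ql.
  have /andP[qi qm] : (q %| i)%N && (q %| m)%N by rewrite -dvdn_gcd pdiv_dvd.
  have qqs : q \in qs.
    have := cov q ql qm; case: (boolP (q %| e)%N) => //= qe.
    have := dvdn_gcd q e i; rewrite qe qi (eqP P0i) dvdn1 => /eqP q1.
    by rewrite q1 in ql.
  rewrite (big_rem q) //= (mem_expset gP); last by move=> j; exact: perm.
  by rewrite /P qi -/(P0 i) P0i.
pose N : algC := #|I|%:R; pose p : algC := #|F|%:R; pose phi : algC := (totient e)%:R.
have phi0 : 0 < phi by rewrite ltr0n totient_gt0.
have p0 : 0 < p by rewrite ltr0n.
pose kappa := sqrtC (p * phi).
have k0 : 0 <= kappa by rewrite sqrtC_ge0 mulr_ge0 ?ltW.
have k2 : kappa ^+ 2 = (#|F| * totient e)%:R by rewrite sqrtCK natrM.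
(* One error term serves all the sets: each has [totient e] admissible exponents per period, the
   period being [e] or [e * q]. *)
pose X := kappa * (p * N - N ^+ 2).
have Xr : X \is Num.real by rewrite !(rpredM, rpredB, rpredX) ?ger0_real.
have lo : N ^+ 2 * (m %/ e * totient e)%:R - X <= p * (r P0)%:R.
  have := sumset_expset_count I psi0 psiD psic psi1 gP dve per0 (totient_sum e) k0 k2.
  rewrite real_ler_distl; first by case/andP.
  by rewrite rpredB // rpredM ?rpredX ?realn.
have up q : q \in qs -> p * (r (P q))%:R <= N ^+ 2 * (m %/ (e * q) * totient e)%:R + X.
  move=> qq; have /andP[qm eq] := qsP _ qq.
  have dq : (e * q %| m)%N by rewrite Gauss_dvd // dve.
  have := sumset_expset_count I psi0 psiD psic psi1 gP dq (per q)
    (totient_sum_multiples (q0 _ qq) eq) k0 k2.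
  rewrite real_ler_distl; first by case/andP.
  by rewrite rpredB // rpredM ?rpredX ?realn.
have ne0 : (0 < #|I|)%N by case: #|I| big.
have N0 : 0 < N by rewrite ltr0n.
(* The main term for [q] is [q%:R^-1] times that of [A_0]; inserting [lo] and [up] into [cover]
   leaves one error from [A_0] and one from each [q]. *)
have key : N ^+ 2 * (m%:R * phi / e%:R) * (1 - \sum_(q <- qs) q%:R^-1) <= (size qs).+1%:R * X.
  have : p * (r P0)%:R <= \sum_(q <- qs) (N ^+ 2 * (m%:R * phi / e%:R) * q%:R^-1 + X).
    apply: (@le_trans _ _ (p * (\sum_(q <- qs) r (P q))%:R)).
      by rewrite ler_wpM2l ?(ltW p0) ?ler_nat.
    rewrite natr_sum mulr_sumr big_seq [leRHS]big_seq; apply: ler_sum => q qq.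
    apply: le_trans (up q qq) _; rewrite lerD2r natrM natf_div; last first.
      by have /andP[qm eq] := qsP _ qq; rewrite Gauss_dvd // dve.
    rewrite le_eqVlt; apply/orP; left; apply/eqP; rewrite natrM /phi; field.
    by rewrite !pnatr_eq0 -!lt0n e0 q0.
  move=> /(le_trans lo); rewrite big_split /= -mulr_sumr big_const_seq iter_addr_0.
  rewrite count_predT natrM natf_div // -/phi [m%:R / _ * _]mulrAC lerBlDr -addrA -mulrSr.
  by rewrite mulrBr mulr1 lerBlDl [_%:R * X]mulr_natl.
have d0' : 0 < d%:R :> algC by rewrite ltr0n.
have e0' : 0 < e%:R :> algC by rewrite ltr0n.
have m0' : 0 < m%:R :> algC by rewrite ltr0n.
have Xle : X <= kappa * (N * m%:R).
  rewrite ler_wpM2l // expr2 [p * N]mulrC -mulrBr ler_wpM2l ?(ltW N0) //.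
  by rewrite lerBlDr /p -mE -natr1 lerD2l ler1n.
have : N * phi <= ((size qs).+1 * d * e)%:R * kappa.
  have : N ^+ 2 * (m%:R * phi / e%:R) * d%:R^-1 <= (size qs).+1%:R * (kappa * (N * m%:R)).
    apply: le_trans (le_trans key _); last by rewrite ler_wpM2l.
    rewrite ler_wpM2l //; last by rewrite lerBrDl -lerBrDr.
    by rewrite mulr_ge0 ?exprn_ge0 ?divr_ge0 ?mulr_ge0 ?ltW.
  have -> : N ^+ 2 * (m%:R * phi / e%:R) / d%:R = (N * m%:R) * (N * phi) / (d%:R * e%:R).
    by field; rewrite !gt_eqF.
  rewrite ler_pdivrMr ?mulr_gt0 //.
  have -> : (size qs).+1%:R * (kappa * (N * m%:R)) * (d%:R * e%:R) =
      (N * m%:R) * (((size qs).+1 * d * e)%:R * kappa).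
    by rewrite !natrM; ring.
  by rewrite ler_pM2l ?mulr_gt0.
have Np0 : 0 <= N * phi by rewrite ltW ?mulr_gt0.
rewrite -(@ler_pXn2r _ 2) ?nnegrE ?(mulr_ge0 _ k0) // !exprMn k2.
rewrite [(#|F| * _)%:R]natrM [phi ^+ 2]expr2 !mulrA ler_pM2r //.
by rewrite -!natrX -!natrM ler_nat leqNgt big.
Qed.

(** Here [I] is [{1, ..., N}], of size [N] because [N < p], and [psi x = z ^+ x] for a complex
    primitive [p]-th root of unity [z]. *)
Lemma Fp_sumset_prim_root (p : nat) (e d N : nat) (qs : seq nat) :
  prime p -> (e %| p.-1)%N -> (0 < d)%N -> (N < p)%N ->
  {in qs, forall q, (q %| p.-1)%N && coprime e q} ->
  (forall q, prime q -> (q %| p.-1)%N -> (q %| e)%N || (q \in qs)) ->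
  \sum_(q <- qs) q%:R^-1 <= 1 - d%:R^-1 :> rat ->
  (((size qs).+1 * d * e) ^ 2 * p < N ^ 2 * totient e)%N ->
  exists2 h, (0 < h <= N.*2)%N & (p.-1).-primitive_root (h%:R : 'F_p).
Proof.
move=> pp dve d0 Np qsP cov sumq big.
have [z zP] := C_prim_root_exists (prime_gt0 pp).
pose psi (x : 'F_p) : algC := z ^+ x.
have psi0 : psi 0 = 1 by rewrite /psi expr0.
have psiD x y : psi (x + y) = psi x * psi y.
  rewrite /psi -exprD -(prim_expr_mod zP (x + y)) /=.
  by move: (nat_of_ord x + nat_of_ord y)%N => a; rewrite Fp_Zcast // Zp_cast // prime_gt1.
have z1 : `|z| = 1.
  apply/eqP; rewrite -(@pexpr_eq1 _ _ p) ?prime_gt0 // -normrX.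
  by rewrite (prim_expr_order zP) normr1.
have psi_conj x : (psi x)^* = psi (- x).
  have nz : psi x != 0 by rewrite expf_neq0 // -normr_eq0 z1 oner_eq0.
  apply: (mulfI nz); rewrite -psiD subrr psi0 -normCK /psi normrX z1 !expr1n //.
have psi1 : exists x, psi x != 1.
  exists 1; rewrite /psi -(prim_order_dvd zP) /=.
  by rewrite modn_small // gtnNdvd ?prime_gt1.
pose I : {set 'F_p} := [set i.+1%:R | i : 'I_N].
have cI : #|I| = N.
  rewrite card_imset ?card_ord // => i j /(congr1 val) /=.
  rewrite !val_Fp_nat // => /eqP.
  by rewrite !modn_small ?(leq_ltn_trans (ltn_ord _)) // => /eqP[/val_inj].
have := @sumset_prim_root _ psi I e d qs psi0 psiD psi_conj psi1.
rewrite card_Fp // cI => /(_ dve d0 qsP cov).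
case.
- move: sumq; rewrite -(ler_rat algC) rmorph_sum rmorphB rmorph1 fmorphV rmorph_nat.
  by rewrite (eq_bigr (fun q => q%:R^-1)) // => q _; rewrite fmorphV rmorph_nat.
- by [].
move=> _ [_ [/imsetP[i _ ->] /imsetP[j _ ->] ij]].
exists (i.+1 + j.+1)%N; last by rewrite natrD.
by rewrite -addnn leq_add.
Qed.

Local Close Scope ring_scope.

(** * Products of distinct primes, and the passage to the bound [p^(5/8)] *)

Lemma coprime_prod_prime (s : seq nat) (q : nat) :
  all prime s -> prime q -> q \notin s -> coprime (\prod_(r <- s) r) q.
Proof.
move=> /allP sP qP qs; rewrite coprime_sym big_seq.
elim/big_rec: _ => [|r x rs]; first by rewrite coprimen1.
rewrite coprimeMr => ->; rewrite andbT prime_coprime // dvdn_prime2 ?(sP _ rs) //.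
by apply: contraNneq qs => ->.
Qed.

Lemma prod_primes_dvd (s : seq nat) (m : nat) :
  uniq s -> all prime s -> {in s, forall q, q %| m} -> \prod_(q <- s) q %| m.
Proof.
elim: s => [|q s IH] /=; first by rewrite big_nil dvd1n.
move=> /andP[qs us] /andP[qP sP] sm; rewrite big_cons mulnC Gauss_dvd ?coprime_prod_prime //.
rewrite IH ?sm ?mem_head // => r rs.
by rewrite sm // inE rs orbT.
Qed.

Lemma dvdn_prod_seq (s : seq nat) (q : nat) : q \in s -> q %| \prod_(r <- s) r.
Proof. by move=> qs; rewrite (big_rem q) //= dvdn_mulr. Qed.

Lemma totient_prod_primes (s : seq nat) :
  uniq s -> all prime s -> totient (\prod_(q <- s) q) = \prod_(q <- s) q.-1.
Proof.
elim: s => [|q s IH] /=; first by rewrite !big_nil.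
move=> /andP[qs us] /andP[qP sP]; rewrite !big_cons mulnC totient_coprime ?coprime_prod_prime //.
by rewrite (totient_prime qP) IH // mulnC.
Qed.

(** Here [M] is an upper bound for [p^(5/8)] and [N] is at least [(b / a) M]. Taking fourth powers
    of the goal turns everything into integer powers. *)
Lemma eighth_root_step (a b N M p f X : nat) : 0 < p -> b * M <= a * N ->
  p ^ 5 <= M ^ 8 -> (a * X) ^ 8 < b ^ 8 * (p * f ^ 4) -> X ^ 2 * p < N ^ 2 * f.
Proof.
move=> p0 bM pM big.
have a0 : 0 < a ^ 8.
  rewrite expn_gt0 lt0n; apply/orP; left; apply: contraTneq big => a0.
  move: bM; rewrite a0 !mul0n leqn0 muln_eq0 => /orP[/eqP ->|/eqP M0].
    by rewrite -leqNgt exp0n.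
  by move: pM; rewrite M0 exp0n // leqn0 expn_eq0 eqn0Ngt p0.
have E x y : (x ^ 2 * y) ^ 4 = x ^ 8 * y ^ 4 by rewrite expnMn -expnM.
have E' x y : a ^ 8 * (x ^ 8 * y) = (a * x) ^ 8 * y by rewrite mulnA -expnMn.
rewrite -(@ltn_exp2r _ _ 4) // !E -(ltn_pmul2l a0) !E'.
apply: (@leq_trans (b ^ 8 * (p * f ^ 4) * p ^ 4)).
  by rewrite ltn_pmul2r ?expn_gt0 ?p0.
have -> : b ^ 8 * (p * f ^ 4) * p ^ 4 = b ^ 8 * p ^ 5 * f ^ 4.
  by rewrite (expnS p 4); move: (b ^ 8) (f ^ 4) (p ^ 4) => u v w; rewrite -!mulnA [v * w]mulnC.
rewrite leq_mul2r; apply/orP; right.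
apply: (@leq_trans (b ^ 8 * M ^ 8)); first by rewrite leq_mul2l pM orbT.
by rewrite -expnMn leq_exp2r.
Qed.

(* [N] is chosen maximal with [2 N < p^(5/8)]; then [p^(5/8) <= 2 N + 2 <= (11/5) N]. *)
Lemma exists_small_prim_root (p e d : nat) (qs : seq nat) :
  prime p -> 2 ^ 8 <= p -> e %| p.-1 -> 0 < d ->
  {in qs, forall q, (q %| p.-1) && coprime e q} ->
  (forall q, prime q -> q %| p.-1 -> (q %| e) || (q \in qs)) ->
  (\sum_(q <- qs) q%:R^-1 <= 1 - d%:R^-1 :> rat)%R ->
  (11 * ((size qs).+1 * d * e)) ^ 8 < 5 ^ 8 * (p * totient e ^ 4) ->
  exists2 h, (0 < h) && (h ^ 8 < p ^ 5) & ((p.-1).-primitive_root (h%:R : 'F_p))%R.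
Proof.
move=> pp p8 dve d0 qsP cov sumq big.
have p1 := prime_gt1 pp; have p0 := prime_gt0 pp.
have exN : exists n, n.*2 ^ 8 < p ^ 5 by exists 0; rewrite exp0n // expn_gt0 p0.
have bdN n : n.*2 ^ 8 < p ^ 5 -> n <= p.
  move=> lt; rewrite leqNgt; apply/negP => pn; move: lt; rewrite ltnNge => /negP; apply.
  apply: (@leq_trans (p ^ 8)); first by rewrite leq_exp2l.
  by rewrite leq_exp2r // -addnn (leq_trans (ltnW pn)) // leq_addr.
case: (ex_maxnP exN bdN) => N ltN maxN.
have geN : p ^ 5 <= N.+1.*2 ^ 8 by rewrite leqNgt; apply/negP => /maxN; rewrite ltnn.
(* The inequality [2 N + 2 <= (11/5) N] needs [N >= 10]. A smaller [N] gives [2 N + 2 <= 20],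
   whereas [p ^ 5 >= 2 ^ 40 = 32 ^ 8]. *)
have N10 : 10 <= N.
  rewrite leqNgt; apply/negP => N10.
  have l1 : (2 ^ 8) ^ 5 <= p ^ 5 by rewrite leq_exp2r.
  have l2 : N.+1.*2 ^ 8 <= 20 ^ 8 by rewrite leq_exp2r // (leq_double _ 10).
  move: (leq_trans l1 (leq_trans geN l2)).
  by rewrite -expnM mulnC expnM leq_exp2r.
have Np : N < p.
  have : N.*2 < p.
    rewrite -(@ltn_exp2r _ _ 8) //; apply: leq_trans ltN _.
    by rewrite leq_exp2l.
  by apply: leq_ltn_trans; rewrite -addnn leq_addr.
have step : ((size qs).+1 * d * e) ^ 2 * p < N ^ 2 * totient e.
  by apply: (eighth_root_step _ _ geN big) => //; clear -N10; lia.
have [h /andP[h0 h2] hP] := Fp_sumset_prim_root pp dve d0 Np qsP cov sumq step.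
exists h => //; rewrite h0 /=; apply: leq_ltn_trans ltN.
by rewrite leq_exp2r.
Qed.

(** * At most 41 prime factors *)

(** The 40 primes from 7 to 191, as many as there can be elements in [qs] below. *)
Definition small_primes : seq nat := [seq q <- iota 7 185 | prime q].

Lemma sum_small_primes : (\sum_(q <- small_primes) q%:R^-1 <= 10%:R / 11%:R :> rat)%R.
Proof.
have -> : small_primes = [:: 7; 11; 13; 17; 19; 23; 29; 31; 37; 41; 43; 47; 53; 59;
  61; 67; 71; 73; 79; 83; 89; 97; 101; 103; 107; 109; 113; 127; 131; 137; 139; 149;
  151; 157; 163; 167; 173; 179; 181; 191] by vm_compute.
rewrite !big_cons big_nil; lra.
Qed.

Lemma ler_natV (a b : nat) : 0 < a <= b -> (b%:R^-1 <= a%:R^-1 :> rat)%R.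
Proof.
case/andP=> a0 ab; rewrite lef_pV2 ?posrE ?ltr0n ?(leq_trans a0) //.
by rewrite ler_nat.
Qed.

(* Subtracting 1/T from each term makes the terms below T nonnegative and those
   above T nonpositive, so the sum over s is at most that over the primes below T. *)
Lemma sum_inv_exchange (s P : seq nat) (T : nat) :
  uniq s -> uniq P -> {in P, forall q, 0 < q <= T} ->
  {in s, forall q, q \notin P -> T <= q} -> 0 < T -> size s <= size P ->
  (\sum_(q <- s) q%:R^-1 <= \sum_(q <- P) q%:R^-1 :> rat)%R.
Proof.
move=> us uP PT sT T0 sP.
pose f (q : nat) : rat := (q%:R^-1 - T%:R^-1)%R.
have sumf r : (\sum_(q <- r) f q = \sum_(q <- r) q%:R^-1 - T%:R^-1 *+ size r)%R.
  by rewrite big_split /= big_const_seq iter_addr_0 count_predT mulNrn.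
have le1 : (\sum_(q <- s) f q <= \sum_(q <- P) f q)%R.
  rewrite (bigID (mem P)) /= [leRHS](bigID (mem s)) /= lerD //.
    rewrite -big_filter -[leRHS]big_filter.
    rewrite (perm_big [seq q <- P | q \in s]) //=.
    by rewrite uniq_perm ?filter_uniq // => q; rewrite !mem_filter andbC.
  apply: (@le_trans _ _ 0%R).
    rewrite big_seq_cond; apply: sumr_le0 => q /andP[qs qP].
    by rewrite /f subr_le0 ler_natV // T0 sT.
  rewrite big_seq_cond; apply: sumr_ge0 => q /andP[qP _].
  by rewrite /f subr_ge0 ler_natV // PT.
move: le1; rewrite !sumf lerBlDr => /le_trans; apply.
by rewrite -addrA gerDl addrC subr_le0 ler_wpMn2l ?invr_ge0.
Qed.

Lemma sum_inv_primes_gt5 (s : seq nat) :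
  uniq s -> {in s, forall q, prime q && (5 < q)} -> size s <= 40 ->
  (\sum_(q <- s) q%:R^-1 <= 1 - 11%:R^-1 :> rat)%R.
Proof.
move=> us sP s40; apply: (@le_trans _ _ (10%:R / 11%:R)%R); last by lra.
apply: le_trans sum_small_primes; apply: (@sum_inv_exchange _ _ 192) => //.
- by apply/allP; vm_compute.
- move=> q /sP /andP[qP q5]; rewrite mem_filter qP mem_iota.
  have : q != 6 by apply: contraTneq qP => ->.
  by move: q5; clear; lia.
Qed.

(** Writing [e ^ 8] as [(e ^ 2) ^ 4] and bounding [e ^ 2 / f] by [C / B] cancels [f ^ 4] and leaves
    a numerical condition on [p]. *)
Lemma few_primes_step (A B C D e f p : nat) : 0 < f -> 0 < B ->
  e ^ 2 * B <= C * f -> A ^ 8 * C ^ 4 < D * B ^ 4 * p -> (A * e) ^ 8 < D * (p * f ^ 4).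
Proof.
move=> f0 B0 eB num; rewrite -(@ltn_pmul2r (B ^ 4)) ?expn_gt0 ?B0 //.
apply: (@leq_ltn_trans (A ^ 8 * C ^ 4 * f ^ 4)).
  have -> : (A * e) ^ 8 * B ^ 4 = A ^ 8 * (e ^ 2 * B) ^ 4.
    by rewrite expnMn (expnMn (e ^ 2)) -expnM mulnA.
  by rewrite -mulnA -expnMn leq_mul2l leq_exp2r // eB orbT.
have -> : D * (p * f ^ 4) * B ^ 4 = D * B ^ 4 * p * f ^ 4.
  by move: (f ^ 4) (B ^ 4) => u v; clear; lia.
by rewrite ltn_pmul2r // expn_gt0 f0.
Qed.

Lemma prim_root_few_primes (p : nat) :
  prime p -> 267 * 10 ^ 30 < p -> size (primes p.-1) <= 41 ->
  exists2 h, (0 < h) && (h ^ 8 < p ^ 5) & ((p.-1).-primitive_root (h%:R : 'F_p))%R.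
Proof.
move=> pP pbig; set m := p.-1 => n41.
have p256 : 2 ^ 8 <= p by apply: leq_trans (ltnW pbig); clear; lia.
have p2 : 2 < p by apply: leq_trans p256.
have m0 : 0 < m by rewrite /m; case: (p) p2 => [|[]].
pose core := [seq q <- [:: 2; 3; 5] | q %| m].
pose qs := [seq q <- primes m | 5 < q].
have coreP q : q \in core -> prime q && (q %| m).
  by rewrite mem_filter => /andP[->]; rewrite !inE => /or3P[] /eqP ->.
have qsP q : q \in qs -> [&& prime q, 5 < q & q %| m].
  by rewrite mem_filter mem_primes => /and4P[-> -> _ ->].
have core_uniq : uniq core by rewrite filter_uniq.
have core_prime : all prime core by apply/allP => q /coreP /andP[].
(* Since [p] is odd, 2 is among the at most 41 primes dividing [m] and does not count in [qs]. *)
have size_qs : size qs <= 40.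
  have two : 2 \in primes m.
    rewrite mem_primes m0 /= dvdn2 /m -subn1 oddB ?prime_gt0 //=.
    by case: (even_prime pP) p2 => [-> //|-> _].
  rewrite -ltnS; apply: leq_trans n41.
  rewrite size_filter -(count_predC (fun q => 5 < q)) -addn1 leq_add2l -has_count.
  by apply/hasP; exists 2.
have e_dvd : \prod_(q <- core) q %| m.
  by apply: prod_primes_dvd => // q /coreP /andP[].
apply: (@exists_small_prim_root p (\prod_(q <- core) q) 11 qs).
- exact: pP.
- exact: p256.
- exact: e_dvd.
- exact: isT.
- move=> q qq; have /and3P[qP q5 qm] := qsP q qq; rewrite qm coprime_prod_prime //.
  by rewrite mem_filter !inE !gtn_eqF ?andbF // (leq_trans _ q5).
- move=> q qP qm; have [q5|q5] := ltnP 5 q.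
    by rewrite mem_filter q5 mem_primes qP m0 qm !orbT.
  rewrite dvdn_prod_seq // mem_filter qm !inE.
  by case: q qP q5 {qm} => [|[|[|[|[|[|]]]]]].
- apply: sum_inv_primes_gt5 => //; first by rewrite filter_uniq ?primes_uniq.
  by move=> q /qsP /and3P[-> ->].
(* [4961 = 11 * 41 * 11], and [e^2 / phi(e)] is largest at [e = 30], where it is [900 / 8]. *)
apply: (@leq_ltn_trans ((4961 * \prod_(q <- core) q) ^ 8)).
  rewrite leq_exp2r // mulnA leq_mul2r; apply/orP; right.
  by clear -size_qs; lia.
apply: (@few_primes_step _ 8 900).
- by rewrite totient_gt0 (dvdn_gt0 m0 e_dvd).
- exact: isT.
- by rewrite /core /=; case: (2 %| m); case: (3 %| m); case: (5 %| m);
    rewrite ?big_cons big_nil.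
(* The numerical condition amounts to [p] exceeding about [1.505 * 10^32], which the assumed bound
   guarantees. *)
apply: (@leq_ltn_trans (5 ^ 8 * 8 ^ 4 * (267 * 10 ^ 30))); first by clear; lia.
by rewrite ltn_pmul2l.
Qed.

(** * At least 42 prime factors *)

Lemma prime_gt3_mod (q : nat) : prime q -> 3 < q -> (q %% 2 != 0) && (q %% 3 != 0).
Proof.
move=> qP q3; rewrite -!/(dvdn _ _) !dvdn_prime2 //.
by clear -q3; lia.
Qed.

(* The integers coprime to 6 exceeding 3 come in pairs 6j+5, 6j+7. *)
Lemma nth_primes_ge (s : seq nat) (i : nat) :
  sorted ltn s -> all prime s -> i < size s -> (3 * i.-1).+1 <= nth 0 s i.
Proof.
move=> srt /allP sP.
have nP k : k < size s -> prime (nth 0 s k) by move=> ks; rewrite sP ?mem_nth.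
have nS k : k.+1 < size s -> nth 0 s k < nth 0 s k.+1.
  by move=> ks; move/(sortedP 0): srt; apply.
have nM k : k < size s -> 3 < nth 0 s k ->
    (nth 0 s k %% 2 != 0) && (nth 0 s k %% 3 != 0).
  by move=> /nP; apply: prime_gt3_mod.
(* Indices 0 and 1 are set aside because 2 and 3 may stand there. The bound [3 (i - 1) + 1] equals
   the second value of each pair and is one below the first. *)
have main j : (j.*2.+2 < size s -> 6 * j + 5 <= nth 0 s j.*2.+2) /\
              (j.*2.+3 < size s -> 6 * j + 7 <= nth 0 s j.*2.+3).
  have odd_of k : (k.*2.+2 < size s -> 6 * k + 5 <= nth 0 s k.*2.+2) ->
      (k.*2.+3 < size s -> 6 * k + 7 <= nth 0 s k.*2.+3).
    move=> even js; have := nS _ js; have := nM _ js; have := even (ltnW js).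
    by clear; lia.
  elim: j => [|j [_ IH]].
    suff h : 2 < size s -> 5 <= nth 0 s 2 by split=> //; apply: (odd_of 0).
    move=> s2; have s1 := ltnW s2; have s0 := ltnW s1.
    have := prime_gt1 (nP _ s0); have := nS _ s1; have := nS _ s2; have := nM _ s2.
    by clear; lia.
  suff h : j.+1.*2.+2 < size s -> 6 * j.+1 + 5 <= nth 0 s j.+1.*2.+2.
    by split=> //; apply: odd_of.
  rewrite doubleS => js; have := nS _ js; have := nM _ js; have := IH (ltnW js).
  by clear; lia.
(* Truncated subtraction makes the bound 1 at both indices 0 and 1. *)
case: i => [|[|i]] is_; first by rewrite /= prime_gt0 ?nP.
  by rewrite /= prime_gt0 ?nP.
rewrite -(odd_double_half i) in is_ *.
by case: (odd i) is_; rewrite ?add1n ?add0n => is_; have [m1 m2] := main i./2;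
  [have := m2 is_ | have := m1 is_]; clear; lia.
Qed.

(** The product of the [q / (q - 1)] is largest for consecutive integers [a + 1, a + 2, ...], where
    it telescopes to [(a + size s) / a]. *)
Lemma prod_le_totient_path (a : nat) (s : seq nat) : path ltn a s ->
  a * \prod_(q <- s) q <= (a + size s) * \prod_(q <- s) q.-1.
Proof.
elim: s a => [|q s IH] a /=; first by rewrite !big_nil addn0.
case/andP=> aq /IH; rewrite !big_cons.
move: (\prod_(r <- s) r) (\prod_(r <- s) r.-1) => u v h.
apply: (@leq_trans (a * ((q + size s) * v))); first by rewrite leq_mul2l h orbT.
rewrite !mulnA leq_mul2r; apply/orP; right.
case: q aq {h} => // q aq; rewrite /=; nia.
Qed.

(** With [M] the entry at index [k], the first [k] entries have product at most [M ^ k], and the at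
    least [6 k] others have product at least [M ^ (6 * k)]. *)
Lemma prod_take_exp_le (s : seq nat) (k : nat) : sorted ltn s -> 0 < k ->
  7 * k <= size s -> 0 < head 0 s -> (\prod_(q <- take k s) q) ^ 7 <= \prod_(q <- s) q.
Proof.
move=> srt k0 ks hd.
have kn : k < size s by clear -k0 ks; lia.
have srtl : sorted leq s by apply: sub_sorted srt => x y /ltnW.
pose M := nth 0 s k.
have M0 : 0 < M.
  apply: leq_trans hd _; rewrite -nth0.
  by apply: (sorted_leq_nth leq_trans leqnn) => //; rewrite inE ?(leq_ltn_trans _ kn).
have up : \prod_(q <- take k s) q <= M ^ k.
  rewrite (big_nth 0) size_take kn.
  rewrite -[X in M ^ X]subn0 -prod_nat_const_nat big_nat [leqRHS]big_nat.
  elim/big_ind2: _ => [//|a b c d ab cd|i /andP[_ ik]]; first exact: leq_mul.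
  rewrite nth_take //; apply: (sorted_leq_nth leq_trans leqnn) => //.
  - by rewrite inE (ltn_trans ik).
  - exact: ltnW.
have lo : M ^ (size s - k) <= \prod_(q <- drop k s) q.
  rewrite (big_nth 0) size_drop.
  rewrite -[X in M ^ X]subn0 -prod_nat_const_nat big_nat [leqRHS]big_nat.
  elim/big_ind2: _ => [//|a b c d ab cd|i /andP[_ ik]]; first exact: leq_mul.
  rewrite nth_drop; apply: (sorted_leq_nth leq_trans leqnn) => //.
  - by rewrite inE -ltn_subRL.
  - exact: leq_addr.
rewrite -[in leqRHS](cat_take_drop k s) big_cat /= expnS leq_mul2l; apply/orP; right.
apply: leq_trans lo; apply: (@leq_trans ((M ^ k) ^ 6)); first by rewrite leq_exp2r.
by rewrite -expnM leq_pexp2l //; clear -ks; lia.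
Qed.

(** * Products and reciprocal sums of the numbers [3 (i - 1) + 1] *)

Lemma expn_ratio (a b K n t : nat) : 0 < b -> a ^ t <= b ^ t * K -> b * n.+1 <= a * n ->
  n.+1 ^ t <= n ^ t * K.
Proof.
move=> b0 abK ban; have bt : 0 < b ^ t by rewrite expn_gt0 b0.
rewrite -(leq_pmul2l bt) -expnMn.
apply: (@leq_trans ((a * n) ^ t)); first by case: (t) => // t'; rewrite leq_exp2r.
by rewrite expnMn mulnCA [leqRHS]mulnC leq_mul2r abK orbT.
Qed.

(** From [n] to [n + 1] the left side grows by a factor at most [K], the right side by one at least
    [K]. *)
Lemma prod_growth (C t n0 K : nat) (b : nat -> nat) :
  (forall n, n0 <= n -> n.+1 ^ t <= n ^ t * K) -> (forall n, n0 <= n -> K <= b n) ->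
  C * n0 ^ t <= \prod_(0 <= i < n0) b i ->
  forall n, n0 <= n -> C * n ^ t <= \prod_(0 <= i < n) b i.
Proof.
move=> ratio bK base n /subnKC <-; elim: (n - n0) => [|k IH]; first by rewrite addn0.
rewrite addnS big_nat_recr //=.
apply: leq_trans (leq_mul IH (bK _ (leq_addr _ _))).
by rewrite -mulnA leq_mul2l ratio ?leq_addr // orbT.
Qed.

(** The exponents suit [many_primes_step]: the cube of the left side is [11 ^ 57 * n ^ 84]. The case
    [n = 42] is a computation, and [(43 / 42) ^ 28 <= 3] drives the growth. *)
Lemma prod_shift_growth (n : nat) : 42 <= n ->
  11 ^ 19 * n ^ 28 <= \prod_(0 <= i < n) (3 * i.-1).+1.
Proof.
apply: (@prod_growth _ _ _ 3) => [k k42|k k42|].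
- apply: (@expn_ratio 43 42); [exact: isT|clear; lia|clear -k42; lia].
- by clear -k42; lia.
- by rewrite unlock /=; lia.
Qed.

(** The sum does not increase with [k]: one step drops the first term and adds seven, each at most a
    seventh of it. The case [k = 6] is computed. *)
Lemma sum_shift_inv (k : nat) : 6 <= k ->
  (\sum_(k <= i < 7 * k.+1) (3 * i.-1).+1%:R^-1 <= 4%:R / 5%:R :> rat)%R.
Proof.
elim: k => [|k IH]; first by rewrite leqn0.
rewrite leq_eqVlt => /orP[/eqP <-|k6].
  rewrite -(big_map (fun i => (3 * i.-1).+1) xpredT (fun a => a%:R^-1)%R).
  have -> : [seq (3 * i.-1).+1 | i <- index_iota 6 (7 * 7)] = [::
    16; 19; 22; 25; 28; 31; 34; 37; 40; 43; 46; 49; 52; 55; 58;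
    61; 64; 67; 70; 73; 76; 79; 82; 85; 88; 91; 94; 97; 100; 103;
    106; 109; 112; 115; 118; 121; 124; 127; 130; 133; 136; 139; 142] by [].
  rewrite !big_cons big_nil; lra.
have k0 : 0 < k by clear -k6; lia.
apply: le_trans (IH k6).
rewrite (@big_cat_nat _ _ _ (7 * k.+1)) /=; [|by clear; lia|by clear; lia].
rewrite [leRHS]big_ltn; last by clear; lia.
rewrite addrC lerD2r.
apply: (@le_trans _ _ (\sum_(7 * k.+1 <= i < 7 * k.+2) (7 * (3 * k.-1).+1)%:R^-1)%R).
  rewrite big_nat [leRHS]big_nat; apply: ler_sum => i /andP[ki _]; apply: ler_natV.
  by clear -ki k0; lia.
rewrite sumr_const_nat (_ : 7 * k.+2 - 7 * k.+1 = 7); last by clear; lia.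
by rewrite natrM invfM -mulrnAl -(mulr_natr 7%:R^-1)%R mulVf ?mul1r.
Qed.

Lemma sum_inv_drop_primes (s : seq nat) (k : nat) : sorted ltn s -> all prime s ->
  6 <= k -> size s < 7 * k.+1 ->
  (\sum_(q <- drop k s) q%:R^-1 <= 1 - 5%:R^-1 :> rat)%R.
Proof.
move=> srt sP k6 sk; apply: (@le_trans _ _ (4%:R / 5%:R)%R); last by lra.
apply: le_trans (sum_shift_inv k6).
have [ks|sk'] := leqP k (size s); last first.
  by rewrite drop_oversize ?(ltnW sk') // big_nil sumr_ge0 // => i _; rewrite invr_ge0.
rewrite [leRHS](@big_cat_nat _ _ _ (size s)) ?(ltnW sk) //=.
rewrite -[leLHS]addr0; apply: lerD; last by rewrite sumr_ge0 // => i _; rewrite invr_ge0.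
rewrite (big_nth 0) size_drop -[X in (_ <= \sum_(X <= _ < _) _)%R]add0n big_addn.
rewrite big_nat [leRHS]big_nat; apply: ler_sum => i /andP[_ ik].
rewrite nth_drop addnC; apply: ler_natV => /=; apply: nth_primes_ge => //.
by clear -ik; lia.
Qed.

(** Since [S <= n] and [e <= n * f], it suffices that [a ^ 8 * n ^ 12 * e ^ 4 < p]. As [e ^ 7 <= p],
    this follows from [a ^ 56 * n ^ 84 < p ^ 3], which the last hypothesis gives because
    [3 * 19 > 56]. *)
Lemma many_primes_step (a c e f n p k S : nat) : 1 < a -> 0 < n -> 0 < c -> 0 < f ->
  e ^ 7 <= p -> e <= k * f -> k <= n -> S <= n -> a ^ 19 * n ^ 28 <= p ->
  (a * (S * c * e)) ^ 8 < c ^ 8 * (p * f ^ 4).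
Proof.
move=> a1 n0 c0 f0 e7 ek kn Sn big; have a0 : 0 < a := ltnW a1.
have p0 : 0 < p by apply: leq_trans big; rewrite muln_gt0 !expn_gt0 a0 n0.
have Y : a ^ 8 * n ^ 12 * e ^ 4 < p.
  rewrite -(@ltn_exp2r _ _ 7) //.
  apply: (@leq_ltn_trans (a ^ 56 * n ^ 84 * p ^ 4)).
    have -> : (a ^ 8 * n ^ 12 * e ^ 4) ^ 7 = a ^ 56 * n ^ 84 * (e ^ 7) ^ 4.
      by rewrite expnMn expnMn -!expnM.
    by rewrite leq_mul2l leq_exp2r // e7 orbT.
  rewrite (_ : p ^ 7 = p ^ 3 * p ^ 4); last by rewrite -expnD.
  rewrite ltn_pmul2r ?expn_gt0 ?p0 //.
  apply: (@leq_trans ((a ^ 19 * n ^ 28) ^ 3)); last by rewrite leq_exp2r.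
  rewrite expnMn -!expnM ltn_pmul2r ?expn_gt0 ?n0 //.
  by rewrite ltn_exp2l.
have -> : (a * (S * c * e)) ^ 8 = c ^ 8 * (a * S * e) ^ 8.
  by rewrite -expnMn; congr (_ ^ _); clear; lia.
rewrite ltn_pmul2l ?expn_gt0 ?c0 //.
apply: (@leq_ltn_trans (a ^ 8 * n ^ 12 * e ^ 4 * f ^ 4)); last first.
  by rewrite ltn_pmul2r ?expn_gt0 ?f0.
have -> : a ^ 8 * n ^ 12 * e ^ 4 * f ^ 4 = (a * n) ^ 8 * (e ^ 4 * (n * f) ^ 4).
  rewrite !expnMn (_ : n ^ 12 = n ^ 8 * n ^ 4); last by rewrite -expnD.
  by move: (a ^ 8) (n ^ 8) (n ^ 4) (e ^ 4) (f ^ 4); clear; lia.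
rewrite expnMn leq_mul ?leq_exp2r // ?leq_mul2l ?Sn ?orbT //.
rewrite (_ : e ^ 8 = e ^ 4 * e ^ 4); last by rewrite -expnD.
rewrite leq_mul2l leq_exp2r //; apply/orP; right.
by rewrite (leq_trans ek) // leq_mul2r kn orbT.
Qed.

Lemma prim_root_many_primes (p : nat) :
  prime p -> 2 ^ 8 <= p -> 42 <= size (primes p.-1) ->
  exists2 h, (0 < h) && (h ^ 8 < p ^ 5) & ((p.-1).-primitive_root (h%:R : 'F_p))%R.
Proof.
move=> pP p256; set m := p.-1; set s := primes m; set n := size s => n42.
have p1 := prime_gt1 pP.
have m0 : 0 < m by rewrite /m; case: (p) p1 => [|[]].
pose k := n %/ 7.
have kn : 7 * k <= n < 7 * k.+1 by rewrite /k; clear; lia.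
have k6 : 6 <= k by clear -kn n42; lia.
have srt : sorted ltn s := sorted_primes m.
have us : uniq s := primes_uniq m.
have sP : all prime s by apply/allP => q; rewrite mem_primes => /andP[].
have sm q : q \in s -> q %| m by rewrite mem_primes => /and3P[].
pose core := take k s; pose qs := drop k s; pose e := \prod_(q <- core) q.
have core_s q : q \in core -> q \in s by apply: mem_take.
have qs_s q : q \in qs -> q \in s by apply: mem_drop.
have coreP : all prime core by apply/allP => q /core_s; apply/allP.
have ucore : uniq core by rewrite take_uniq.
have e_dvd : e %| m by apply: prod_primes_dvd => // q /core_s /sm.
have prod_le : \prod_(q <- s) q <= p.
  by apply: leq_trans (leq_pred p); apply: dvdn_leq => //; apply: prod_primes_dvd.
have szqs : size qs = n - k by rewrite size_drop.
have szcore : size core = k by rewrite size_take -/n; case: ltnP => //; clear -kn; lia.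
apply: (@exists_small_prim_root p e 5 qs).
- exact: pP.
- exact: p256.
- exact: e_dvd.
- exact: isT.
- move=> q qq; rewrite sm ?qs_s // coprime_prod_prime ?(allP sP) ?qs_s //.
  move: us; rewrite -(cat_take_drop k s) cat_uniq => /and3P[_ /hasPn h _].
  exact: h.
- move=> q qP qm; have : q \in s by rewrite mem_primes qP m0 qm.
  rewrite -{1}(cat_take_drop k s) mem_cat => /orP[qc|->]; last by rewrite orbT.
  by rewrite dvdn_prod_seq.
- by apply: sum_inv_drop_primes => //; case/andP: kn.
(* The choice [d = 5] cancels the denominator of [11/5]; [k + 1] bounds [e / totient e] by
   telescoping from 1. *)
apply: (@many_primes_step 11 5 e _ n p k.+1) => //.
- by clear -n42; lia.
- by rewrite totient_gt0 (dvdn_gt0 m0 e_dvd).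
- apply: leq_trans prod_le; apply: prod_take_exp_le => //.
  + by clear -k6; lia.
  + by case/andP: kn.
  + rewrite -nth0 prime_gt0 // (allP sP) // mem_nth //.
    exact: leq_trans n42.
- rewrite /e totient_prod_primes //.
  have := @prod_le_totient_path 1 core; rewrite mul1n szcore add1n; apply.
  rewrite path_min_sorted ?take_sorted //.
  by apply: sub_all coreP => q /prime_gt1.
- by clear -kn k6; lia.
- by rewrite szqs; clear -kn k6; lia.
- apply: leq_trans (prod_shift_growth n42) _; apply: leq_trans prod_le.
  rewrite [leqRHS](big_nth 0) big_nat [leqRHS]big_nat.
  elim/big_ind2: _ => [//|a b c d ab cd|i /andP[_ ik]]; first exact: leq_mul.
  exact: nth_primes_ge.
Qed.

(** * Transfer to the natural and real numbers of the statement *)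

Lemma small_prim_root (p : nat) : prime p -> 267 * 10 ^ 30 < p ->
  exists2 h, (0 < h) && (h ^ 8 < p ^ 5) & ((p.-1).-primitive_root (h%:R : 'F_p))%R.
Proof.
move=> pP pbig; have [n41|n42] := leqP (size (primes p.-1)) 41.
  exact: prim_root_few_primes.
apply: prim_root_many_primes => //.
by apply: leq_trans (ltnW pbig); clear; lia.
Qed.

Lemma Nat_powE (a n : nat) : Nat.pow a n = a ^ n.
Proof. by elim: n => //= n ->; rewrite expnS. Qed.

Lemma Nat_moduloE (a n : nat) : 0 < n -> Nat.modulo a n = a %% n.
Proof.
move=> n0; symmetry; apply: (PeanoNat.Nat.mod_unique _ _ (a %/ n)).
  by apply/ssrnat.ltP; rewrite ltn_pmod.
by rewrite multE plusE mulnC -divn_eq.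
Qed.

Lemma Fp_nat_eq1 (p a : nat) : prime p ->
  ((a%:R : 'F_p) == 1)%R = (a %% p == 1).
Proof.
move=> pP; have p1 := prime_gt1 pP.
by rewrite -(inj_eq val_inj) /= val_Fp_nat // -(val_Fp_nat pP 1) modn_small.
Qed.

Lemma prim_root_is_primitive_root (p h : nat) : prime p ->
  ((p.-1).-primitive_root (h%:R : 'F_p))%R -> is_primitive_root p h.
Proof.
move=> pP hP; have p1 := prime_gt1 pP; have p0 := prime_gt0 pP.
(* Both conditions on powers of [h] become divisibility of [k] by [p - 1]. *)
have pow_mod k : (Nat.modulo (Nat.pow h k) p == 1) = (p.-1 %| k).
  by rewrite Nat_powE Nat_moduloE // -Fp_nat_eq1 // natrX (prim_order_dvd hP).
split; [|split].
- have ch : coprime h p.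
    rewrite coprime_sym prime_coprime //; apply/negP => ph.
    (* If [p] divided [h], then [h ^ (p - 1)] would be 0 modulo [p], not 1. *)
    have := pow_mod p.-1; rewrite dvdnn Nat_powE Nat_moduloE //.
    have m0 : 0 < p.-1 := prim_order_gt0 hP.
    by rewrite -modnXm (eqP ph) exp0n // mod0n.
  have [a ha] := PeanoNat.Nat.gcd_divide_l h p.
  have [b pb] := PeanoNat.Nat.gcd_divide_r h p.
  apply/eqP; rewrite -dvdn1 -(eqP ch) dvdn_gcd.
  by apply/andP; split; apply/dvdnP; [exists a | exists b].
- rewrite [RHS]Nat_moduloE // [RHS]modn_small //; apply/eqP.
  by rewrite pow_mod minusE subn1.
- move=> k /ssrnat.leP k0 /ssrnat.ltP; rewrite minusE subn1 => kp /eqP; rewrite pow_mod.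
  by rewrite gtnNdvd.
Qed.

Lemma exists_primitive_root_lt (p : nat) : prime p -> 267 * 10 ^ 30 < p ->
  exists h, [/\ le 1 h, is_primitive_root p h & lt (Nat.pow h 8) (Nat.pow p 5)].
Proof.
move=> pP /(small_prim_root pP)[h /andP[h0 hp] hP]; exists h; split.
- exact/ssrnat.leP.
- exact: prim_root_is_primitive_root.
- by rewrite !Nat_powE; apply/ssrnat.ltP.
Qed.

From Stdlib Require Import Arith ZArith Znumtheory Reals.

Lemma prime_of_Zprime (p : nat) : prime (Z.of_nat p) -> prime.prime p.
Proof.
move=> pP; have p1 := prime_ge_2 _ pP.
apply/primeP; split=> [|d /dvdnP[k pk]]; first by lia.
have /(prime_divisors _ pP) dP : (Z.of_nat d | Z.of_nat p)%Z.
  by exists (Z.of_nat k); rewrite -Nat2Z.inj_mul pk.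
by rewrite /=; lia.
Qed.

(** Comparing eighth powers suffices, and the eighth power of [p^(5/8)] is [p ^ 5]. *)
Lemma INR_lt_Rpower (p h : nat) : lt 0 p -> lt (Nat.pow h 8) (Nat.pow p 5) ->
  (INR h < Rpower (INR p) (5 / 8))%R.
Proof.
move=> p0 hp; have pR : (0 < INR p)%R by apply: lt_0_INR.
apply: Rnot_le_lt => le.
have : (Rpower (INR p) (5 / 8) ^ 8 <= INR h ^ 8)%R.
  by apply: pow_incr; split=> //; apply: Rlt_le; apply: exp_pos.
rewrite -Rpower_pow; last exact: exp_pos.
rewrite Rpower_mult (_ : 5 / 8 * INR 8 = INR 5)%R; last by rewrite /=; field.
by rewrite Rpower_pow // -!pow_INR => /INR_le /Nat.le_ngt.
Qed.

Theorem theorem1 :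
  forall p g : nat,
    prime (Z.of_nat p) ->
    (267 * 10 ^ 30 < INR p)%R ->
    least_primitive_root p g ->
    (INR g < Rpower (INR p) (6309 / 10000))%R.
Proof.
move=> p g pP pbig [_ [_ gmin]].
have p2 := prime_ge_2 _ pP.
case: (exists_primitive_root_lt (prime_of_Zprime pP)) => [|h [h1 hP hp]].
  by move: pbig; rewrite INR_IZR_INZ pow_IZR -mult_IZR => /lt_IZR; lia.
have gh : (INR g <= INR h)%R.
  by apply: le_INR; apply/Nat.le_ngt => hg; apply: gmin hP.
apply: Rle_lt_trans gh _; apply: Rlt_trans (INR_lt_Rpower _ hp) _; first by lia.
(* The exponent obtained is [5/8 = 0.625], below [0.6309]. *)
apply: Rpower_lt; last by Lra.lra.
by rewrite -INR_1; apply: lt_INR; lia.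
Qed.
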